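(* Let $\mathcal H$, $\psi$, $\mathcal H^\psi$, $K_\psi$, $V_1,V_2$, $V_1^\psi, V_2^\psi$ be as in the context and let $\alpha>0$. Let $u_2\in V_2^\psi$ and $z\in V_1$. For $u_1^*\in V_1$ the following statements are equivalent: (i) $u_1^*=\operatorname{argmin}_{u\in V_1}\ \|u-z\|_{\mathcal H}^2+2\alpha\,\psi(u+u_2)$; (ii) there exists $\eta\in \operatorname{Range}\big((\pi_{V_2}|_{\mathcal H^\psi})^*\big)\simeq (V_2^\psi)'$ such that $0\in u_1^*-(z-\eta)+\alpha\,\partial_{\mathcal H^\psi}\psi(u_1^*+u_2)$. Moreover, the following statements are equivalent: (iii) there exists $\eta\in V_2$ such that $u_1^*:=(I-P_{\alpha K_\psi})(z+u_2-\eta)-u_2=\mathbb S_\alpha^\psi(z+u_2-\eta)-u_2$ belongs to $V_1$; (iv) there exists $\eta\in V_2$ such that $\eta=\pi_{V_2}P_{\alpha K_\psi}\big(\eta-(z+u_2)\big)$; and they imply (i) and (ii) for the element $u_1^*$ given by the formula in (iii).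
   Context: $\mathcal H$ is a real separable Hilbert space. The function $\psi:\mathcal H\to\mathbb R_+\cup\{+\infty\}$ satisfies: $\psi(0)=0$; $\psi(u+v)\le\psi(u)+\psi(v)$ for all $u,v\in\mathcal H$; $\psi(\lambda u)=|\lambda|\psi(u)$ for all $\lambda\in\mathbb R$; and $\psi$ is lower semicontinuous with respect to norm convergence in $\mathcal H$. The set $\mathcal H^\psi=\{u\in\mathcal H:\psi(u)<\infty\}$ is a dense subspace of $\mathcal H$, $\psi|_{\mathcal H^\psi}$ is a seminorm, and $\mathcal H^\psi$ is a Banach space with the norm $\|u\|_{\mathcal H^\psi}=\|u\|_{\mathcal H}+\psi(u)$. There is a further topology $\tau^\psi$ on $\mathcal H^\psi$ such that every bounded sequence in $\mathcal H^\psi$ has a subsequence converging in $\tau^\psi$ to an element of $\mathcal H^\psi$, and $\psi$ is (sequentially) lower semicontinuous with respect to $\tau^\psi$. By density, $\mathcal H^\psi\subset\mathcal H\simeq\mathcal H'\subset(\mathcal H^\psi)'$, with the duality pairing extending the scalar product of $\mathcal H$. $K_\psi\subset\mathcal H$ is the closed convex set such that the convex conjugate $\psi^*(u)=\sup_{v\in\mathcal H}\{\langle v,u\rangle-\psi(v)\}$ is $0$ if $u\in K_\psi$ and $+\infty$ otherwise; it is assumed that $K_\psi=-K_\psi$. For a closed convex set $K\subset\mathcal H$, $P_K$ denotes the orthogonal (nearest point) projection onto $K$, and $\mathbb S_\alpha^\psi:=I-P_{\alpha K_\psi}$. $V_1,V_2$ are closed, mutually orthogonal subspaces with $\mathcal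 H=V_1\oplus V_2$; $\pi_{V_i}$ is the orthogonal projection onto $V_i$; $V_i^\psi:=\mathcal H^\psi\cap V_i$. It is assumed that $\pi_{V_i}|_{\mathcal H^\psi}:\mathcal H^\psi\to V_i^\psi$ is well defined and continuous in the norm of $\mathcal H^\psi$, with range $V_i^\psi$ closed in $\mathcal H^\psi$, $i=1,2$. Its adjoint $(\pi_{V_i}|_{\mathcal H^\psi})^*$ maps $(V_i^\psi)'$ into $(\mathcal H^\psi)'$. For a convex function $F$ on a locally convex space $V$, $\partial_V F(x)=\emptyset$ if $F(x)=\infty$, and otherwise $\partial_V F(x)=\{x^*\in V':\langle x^*,y-x\rangle+F(x)\le F(y)\ \forall y\in V\}$. The sum in (ii) is in $(\mathcal H^\psi)'$. *)

(* Defs.v *)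
From HB Require Import structures.
From mathcomp Require Import all_boot all_order all_algebra.
From mathcomp Require Import all_classical all_reals all_analysis.

Set Implicit Arguments.
Unset Strict Implicit.
Unset Printing Implicit Defensive.

Import Order.TTheory GRing.Theory Num.Theory.
Import numFieldNormedType.Exports.

Local Open Scope classical_set_scope.
Local Open Scope ring_scope.

(* Linear subspaces of a normed space, not necessarily closed, and the normed
   space carried by such a subspace. *)
Section subspaces.
Context {R : realType} {E : normedModType R}.

Record lin_subspace := Subspace {
  subspace_set :> E -> Prop ;
  subspace0 : subspace_set 0 ;
  subspaceP : forall (a : R) (u v : E),
    subspace_set u -> subspace_set v -> subspace_set (a *: u + v) }.

Definition subspace_pred (V : lin_subspace) : {pred E} :=
  fun u => u \in (V : set E).

Lemma subspace_pred_closed (V : lin_subspace) :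
  GRing.subsemimod_closed (subspace_pred V).
Proof.
have VP a u v : u \in subspace_pred V -> v \in subspace_pred V ->
    a *: u + v \in subspace_pred V.
  by rewrite !unfold_in => /set_mem Vu /set_mem Vv; exact/mem_set/subspaceP.
have V0 : 0 \in subspace_pred V.
  by rewrite unfold_in; exact/mem_set/subspace0.
split=> [|a u Vu]; last by rewrite -[_ *: _]addr0; exact: VP.
by split=> // u v Vu Vv; rewrite -[u]scale1r; exact: VP.
Qed.

HB.instance Definition _ (V : lin_subspace) :=
  GRing.isSubmodClosed.Build R E (subspace_pred V) (subspace_pred_closed V).

Record subspace_type (V : lin_subspace) := SubspaceElt {
  subspace_val : E ; _ : subspace_val \in subspace_pred V }.

Section instances.
Variable V : lin_subspace.
HB.instance Definition _ := [isSub of subspace_type V for @subspace_val V].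
HB.instance Definition _ := [Choice of subspace_type V by <:].
HB.instance Definition _ := [SubChoice_isSubLmodule of subspace_type V by <:].

Let norm (u : subspace_type V) : R := `|val u|.

Lemma subspace_normD u v : norm (u + v) <= norm u + norm v.
Proof. exact: ler_normD. Qed.

Lemma subspace_normZ (a : R) u : norm (a *: u) = `|a| * norm u.
Proof. exact: normrZ. Qed.

Lemma subspace_norm_eq0 u : norm u = 0 -> u = 0.
Proof. by move=> /normr0_eq0 u0; apply: val_inj. Qed.

HB.instance Definition _ := Lmodule_isNormed.Build R (subspace_type V)
  subspace_normD subspace_normZ subspace_norm_eq0.
End instances.

End subspaces.
Arguments lin_subspace {R} E.

(* The functional psi, and the space of the u such that psi u < +oo, normed by
   `|u| + psi u. *)
Section extended_seminorm.
Context {R : realType} {H : normedModType R}.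
Local Open Scope ereal_scope.

Record ext_seminorm := ExtSeminorm {
  ext_seminorm_fun :> H -> \bar R ;
  ext_seminorm_ge0 : forall u, 0 <= ext_seminorm_fun u ;
  ext_seminorm0 : ext_seminorm_fun 0%R = 0 ;
  ext_seminormD : forall u v,
    ext_seminorm_fun (u + v)%R <= ext_seminorm_fun u + ext_seminorm_fun v ;
  (* in \bar R, 0 * +oo = 0 *)
  ext_seminormZ : forall (a : R) u,
    ext_seminorm_fun (a *: u)%R = `|a|%:E * ext_seminorm_fun u }.

Variable psi : ext_seminorm.

Definition psi_finite : {pred H} := fun u => psi u < +oo.

Lemma psi_finite_closed : GRing.subsemimod_closed psi_finite.
Proof.
split=> [|a u]; last first.
  rewrite !unfold_in => u_fin; rewrite ext_seminormZ.
  have : psi u \is a fin_num by rewrite ge0_fin_numE// ext_seminorm_ge0.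
  by move=> /fineK <-; rewrite -EFinM ltry.
split=> [|u v]; first by rewrite unfold_in ext_seminorm0 ltry.
rewrite !unfold_in => u_fin v_fin.
by apply: (le_lt_trans (ext_seminormD _ _ _)); exact: lte_add_pinfty.
Qed.

HB.instance Definition _ :=
  GRing.isSubmodClosed.Build R H psi_finite psi_finite_closed.

Record Hpsi := HpsiElt { Hpsi_val : H ; _ : Hpsi_val \in psi_finite }.

HB.instance Definition _ := [isSub of Hpsi for Hpsi_val].
HB.instance Definition _ := [Choice of Hpsi by <:].
HB.instance Definition _ := [SubChoice_isSubLmodule of Hpsi by <:].

Let norm (u : Hpsi) : R := (`|val u| + fine (psi (val u)))%R.

Let psi_val_fin (u : Hpsi) : psi (val u) \is a fin_num.
Proof. by rewrite ge0_fin_numE ?ext_seminorm_ge0//; exact: (valP u). Qed.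

Lemma Hpsi_normD u v : (norm (u + v) <= norm u + norm v)%R.
Proof.
rewrite /norm addrACA lerD ?ler_normD//.
rewrite -fineD// fine_le//; first by rewrite fin_numD !psi_val_fin.
exact: ext_seminormD.
Qed.

Lemma Hpsi_normZ (a : R) u : norm (a *: u)%R = (`|a| * norm u)%R.
Proof.
rewrite /norm (_ : val (a *: u)%R = a *: val u)%R// normrZ ext_seminormZ.
by rewrite -(fineK (psi_val_fin u)) -EFinM/= mulrDr.
Qed.

Lemma Hpsi_norm_eq0 u : norm u = 0%R -> u = 0%R.
Proof.
move=> /eqP; rewrite /norm paddr_eq0//; last exact/fine_ge0/ext_seminorm_ge0.
by move=> /andP[/eqP/normr0_eq0 u0 _]; exact: val_inj.
Qed.

HB.instance Definition _ := Lmodule_isNormed.Build R Hpsi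
  Hpsi_normD Hpsi_normZ Hpsi_norm_eq0.

(* V^psi, as a subspace of Hpsi *)
Section psi_subspace.
Variable V : lin_subspace H.

Let psi_subspaceP (a : R) (u v : Hpsi) :
  V (val u) -> V (val v) -> V (val (a *: u + v)%R).
Proof. exact: subspaceP. Qed.

Definition psi_subspace : lin_subspace Hpsi :=
  @Subspace R Hpsi [set u | V (val u)] (subspace0 V) psi_subspaceP.
End psi_subspace.

End extended_seminorm.
Arguments ext_seminorm {R} H.

(* The topologies on the bare type T; this allows one to
   consider on Hpsi a second topology, unrelated to that of its norm. *)
Definition topology_on (T : Type) := Topological.axioms_ T.

Definition cvg_in (T : Type) (tau : topology_on T) (u : nat -> T) (l : T) : Prop :=
  let Ttau : topologicalType := Topological.Pack tau in
  (u : nat -> Ttau) @ \oo --> (l : Ttau).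

Section duality.
Context {R : realType}.

(* Sums and multiples of functionals are the pointwise ones, from the
   lmodType structure of E -> R^o. *)
Definition topological_dual (E : tvsType R) : set (E -> R^o) :=
  [set p | linear p /\ continuous p].

Definition adjoint (E F : tvsType R) (T : {linear E -> F}) (xi : F -> R^o) :
  E -> R^o := xi \o T.

Definition subdifferential (E : tvsType R) (F : E -> \bar R) (x : E) :
    set (E -> R^o) :=
  [set p | [/\ topological_dual p, F x != +oo%E &
     forall y, ((p (y - x))%:E + F x <= F y)%E]].

End duality.

Definition argmin (R : realType) (T : Type) (A : set T) (J : T -> \bar R) :
    set T :=
  [set u | A u /\ forall v, A v -> (J u <= J v)%E].

Section hilbert.
Context {R : realType} {H : normedModType R}.
Variable ip : {dot H for idfun}.

Definition conjugate (F : H -> \bar R) (u : H) : \bar R :=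
  ereal_sup [set ((ip v u)%:E - F v)%E | v in setT].

Definition nearest (K : set H) (x : H) : H :=
  xget 0 [set p | K p /\ forall q, K q -> `|x - p| <= `|x - q|].

Definition orth_proj (V : set H) (x : H) : H :=
  xget 0 [set p | V p /\ forall v, V v -> ip (x - p) v = 0].

Definition scale_set (alpha : R) (K : set H) : set H :=
  [set alpha *: k | k in K].

Definition shrink (alpha : R) (K : set H) (x : H) : H :=
  x - nearest (scale_set alpha K) x.

(* the embedding of H ~ H' into (Hpsi)' *)
Definition embed (psi : ext_seminorm H) (h : H) : Hpsi psi -> R^o :=
  fun v => ip h (val v).
Arguments embed psi h v : clear implicits.

Definition penalized (psi : ext_seminorm H) (alpha : R) (u2 z u : H) : \bar R :=
  ((`|u - z| ^+ 2)%:E + (2 * alpha)%:E * psi (u + u2)%R)%E.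

(* [0 \in u1 - (z - eta) + alpha * d psi (u1 + u2)] in (Hpsi)', for some eta in
   the range of the adjoint of pi2; the subdifferential is taken at a point of
   Hpsi, hence the inclusion fails unless psi (u1 + u2) < +oo. *)
Definition optimality (psi : ext_seminorm H) (alpha : R) (V2 : lin_subspace H)
    (pi2 : {linear Hpsi psi -> subspace_type (psi_subspace psi V2)})
    (u2 z u1 : H) : Prop :=
  exists2 eta : Hpsi psi -> R^o,
    [set adjoint pi2 xi
      | xi in @topological_dual R (subspace_type (psi_subspace psi V2))] eta &
    exists2 w : Hpsi psi, val w = u1 + u2 &
      [set embed psi u1 - (embed psi z - eta) + alpha *: p
        | p in subdifferential (fun v : Hpsi psi => psi (val v)) w] 0.

End hilbert.
Arguments embed {R H} ip psi h v.

(* Main.v *)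
(** Subtracting the optimality condition of [u1] on [V1] from [psi] shows that
    [(z - u1) / alpha], as a functional on [V1^psi], lies below the finite
    convex function [v |-> psi (w + v) - psi w] with [w = u1 + u2].  A
    Hahn-Banach extension of it to [H^psi] is a subgradient of [psi] at [w]; it
    is automatically continuous since it is at most [psi v], and its defect on
    [V2^psi] is the multiplier [eta].  Conversely the multiplier vanishes on
    [V1], so the subgradient inequality gives quadratic growth of the objective
    on [V1] around [u1].

    For (iii) and (iv), minimizing [|u - x|^2 + 2 alpha psi u] over [H] (the
    parallelogram identity makes minimizing sequences Cauchy) splits
    [x = w + k] with [k] a subgradient of [alpha psi] at [w], whence [k] is the
    projection of [x] on [alpha K] and [w] is its shrinkage.  So (iii) exhibits
    a subgradient lying in [H], with multiplier [eta] itself, and (iii) and (iv)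
    say in two ways that [-k - eta] is in [V1]. *)
From HB Require Import structures.
Require Import Defs.
From mathcomp Require Import all_boot all_order all_algebra.
From mathcomp Require Import all_classical all_reals all_analysis.
From mathcomp Require Import ring lra.
Import Order.TTheory GRing.Theory Num.Theory.
Import numFieldNormedType.Exports.
Local Open Scope classical_set_scope.
Local Open Scope ring_scope.

(** * Hahn-Banach extension below a finite convex function *)

Section hahn_banach.
Context {R : realType} {E : lmodType R}.
Variable q : E -> R.
Hypothesis q_convex : forall t x y, 0 < t -> t < 1 ->
  q (t *: x + (1 - t) *: y) <= t * q x + (1 - t) * q y.

(* Partial linear functionals below [q] are handled through their graphs.
   Single-valuedness need not be required: if (0, r) lies in such a graph, so
   does (0, t r) for all t, whence t r <= q 0 and r = 0. *)
Definition dominated_graph (G : set (E * R^o)) :=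
  [/\ G 0, forall (a : R) p1 p2, G p1 -> G p2 -> G (a *: p1 + p2) &
      forall p, G p -> p.2 <= q p.1].

Lemma dominated_graph_fun G x (r s : R) :
  dominated_graph G -> G (x, r) -> G (x, s) -> r = s.
Proof.
move=> [G0 GP Gq] Gr Gs.
have Gd : G (0, s - r).
  by rewrite (_ : (0, s - r) = -1 *: (x, r) + (x, s)); [exact: GP|
    congr pair => /=; rewrite !scaleN1r addrC ?subrr].
apply/eqP; rewrite eq_sym -subr_eq0; apply: contraT => d0.
(* If [s - r] were nonzero, this multiple of [(0, s - r)] would be [(0, q 0 + 1)], which rises above
   [q 0]. *)
have := Gq _ (GP ((q 0 + 1) / (s - r)) _ _ Gd G0).
rewrite /= scaler0 !addr0 /GRing.scale /= divfK//; lra.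
Qed.

(* The slopes [a] allowed by [s > 0] and by [s < 0] are compatible because
   weighting the two bounds by each other's [|s|] cancels [x0] in a convex
   combination, leaving a point of the domain. *)
Lemma dominated_graph_extend G x0 : dominated_graph G ->
  exists a : R, forall x r s, G (x, r) -> r + s * a <= q (x + s *: x0).
Proof.
move=> [G0 GP Gq].
have q_mix x y (s t : R) : 0 < s -> 0 < t ->
    (s + t) * q ((s / (s + t)) *: x + (t / (s + t)) *: y) <= s * q x + t * q y.
  move=> s0 t0; have st0 : 0 < s + t by exact: addr_gt0.
  have -> : t / (s + t) = 1 - s / (s + t) by field; rewrite gt_eqF.
  rewrite -ler_pdivlMl//; apply: le_trans (q_convex _ _ _ _ _) _ => //.
  - exact: divr_gt0.
  - by rewrite ltr_pdivrMr// mul1r ltrDl.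
  - by rewrite le_eqVlt; apply/orP; left; apply/eqP; field; rewrite gt_eqF.
(* [A] collects the lower bounds that negative multiples of [x0] put on the slope. By [Aub] the
   upper bounds from positive multiples lie above all of them, so [sup A] respects both kinds. *)
pose A := [set b : R | exists x r t, 
  [/\ 0 < t, G (x, r) & b = (r - q (x - t *: x0)) / t]].
have Aub x r s : 0 < s -> G (x, r) -> ubound A ((q (x + s *: x0) - r) / s).
  move=> s0 Gxr _ [y [r' [t [t0 Gy ->]]]].
  have st0 : 0 < s + t by exact: addr_gt0.
  rewrite ler_pdivrMr// mulrAC ler_pdivlMr//.
  have := q_mix (y - t *: x0) (x + s *: x0) s t s0 t0.
  set v := (X in q X) => qv.
  have Gv : G (v, (s * r' + t * r) / (s + t)).
    have -> : (v, (s * r' + t * r) / (s + t)) =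
        (s / (s + t)) *: (y, r') + ((t / (s + t)) *: (x, r) + 0) :> E * R^o.
      congr pair => /=; last first.
        by rewrite /GRing.scale /= addr0; field; rewrite gt_eqF.
      rewrite addr0 /v scalerDr scalerDr addrACA scalerN !scalerA.
      by rewrite (mulrC _ t) (mulrC _ s) mulrA mulrA (mulrC t s) addNr addr0.
    by apply: (GP _ _ _ Gy); exact: GP.
  have := Gq _ Gv; rewrite /= ler_pdivrMr// => Gv'.
  move: qv; rewrite (mulrC (s + t)) => qv; lra.
have A0 : A !=set0 by exists ((0 - q (0 - 1 *: x0)) / 1); exists 0, 0, 1.
exists (sup A) => x r s Gxr.
have [s0|s0|->] := ltgtP s 0.
- have : (r - q (x - (- s) *: x0)) / - s <= sup A.
    apply: ub_le_sup; last by exists x, r, (- s); rewrite oppr_gt0.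
    by exists ((q (0 + 1 *: x0) - 0) / 1); exact: Aub.
  by rewrite scaleNr opprK ler_pdivrMr ?oppr_gt0//; lra.
- have : sup A <= (q (x + s *: x0) - r) / s by apply: ge_sup => //; exact: Aub.
  by rewrite ler_pdivlMr//; lra.
- by rewrite mul0r scale0r !addr0; exact: (Gq (x, r)).
Qed.

(** Zorn's lemma yields a maximal dominated graph. It is total because its one-step extension along
    any [x] is still dominated and so adds nothing. *)
Lemma hahn_banach_graph G0 : dominated_graph G0 ->
  exists G, [/\ G0 `<=` G, dominated_graph G & forall x, exists r, G (x, r)].
Proof.
move=> domG0.
(* [G0] is adjoined inside the predicate so that the empty chain, whose union is empty, is also
   covered. *)
have [F FP totF|A [domA maxA]] :=
    @Zorn_bigcup _ [set A | dominated_graph (A `|` G0)].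
  have [G00 G0P G0q] := domG0.
  (* As the chain is totally ordered, two points of the union already lie in a single dominated
     graph, where their combinations can be formed. *)
  have sub p1 p2 : (\bigcup_(X in F) X `|` G0) p1 ->
      (\bigcup_(X in F) X `|` G0) p2 ->
      exists X, [/\ dominated_graph X, X p1, X p2 &
                    X `<=` \bigcup_(X in F) X `|` G0].
    have FU X : F X -> X `|` G0 `<=` \bigcup_(X in F) X `|` G0.
      by move=> FX; apply: setSU; exact: bigcup_sup.
    move=> [[X FX Xp1]|G0p1] [[Y FY Yp2]|G0p2].
    + have [XY|YX] := totF _ _ FX FY.
        by exists (Y `|` G0); split; [exact: FP|left; exact: XY|left|exact: FU].
      by exists (X `|` G0); split; [exact: FP|left|left; exact: YX|exact: FU].
    + by exists (X `|` G0); split; [exact: FP|left|right|exact: FU].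
    + by exists (Y `|` G0); split; [exact: FP|right|left|exact: FU].
    + by exists G0; split => // ? ?; right.
  split; first by right.
  - move=> a p1 p2 /sub /[apply] -[X [[_ XP _] Xp1 Xp2]]; apply; exact: XP.
  - by move=> p Up; have [X [[_ _ Xq] Xp _ _]] := sub _ _ Up Up; exact: Xq.
exists (A `|` G0); split => //.
move=> x; have [a Ha] := dominated_graph_extend _ x domA.
have [AG0 AGP AGq] := domA.
pose B := [set p : E * R^o | exists v r s,
  [/\ (A `|` G0) (v, r) & p = (v + s *: x, r + s * a)]].
have sAB : A `|` G0 `<=` B.
  by move=> [v r] AGvr; exists v, r, 0; rewrite scale0r mul0r !addr0.
have domB : dominated_graph B.
  split; first exact: sAB.
  - move=> b _ _ [v [r [s [AGv ->]]]] [w [r' [s' [AGw ->]]]].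
    exists (b *: v + w), (b * r + r'), (b * s + s'); split.
      exact: (AGP b (v, r) (w, r')).
    congr pair => /=; first by rewrite scalerDr scalerDl !scalerA addrACA.
    by rewrite /GRing.scale /=; ring.
  - by move=> _ [v [r [s [AGv ->]]]]; exact: Ha.
have BG0 : B `|` G0 = B by apply/setUidPl => p G0p; apply: sAB; right.
have BA : B `<=` A `|` G0.
  apply: contrapT => nBA; apply: (maxA B); last by rewrite /= BG0.
  split; first by apply: subset_trans sAB => p; left.
  by move=> BA; apply: nBA; apply: subset_trans BA _ => p; left.
by exists a; apply: BA; exists 0, 0, 1; split=> //;
  rewrite scale1r mul1r !add0r.
Qed.

(** The majorant is convex rather than sublinear because it will be [psi] recentred at a point,
    which is not positively homogeneous in general. *)
Theorem hahn_banach (V : set E) (f : E -> R) : V 0 ->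
  (forall (a : R) u v, V u -> V v -> V (a *: u + v)) ->
  (forall (a : R) u v, V u -> V v -> f (a *: u + v) = a * f u + f v) ->
  (forall u, V u -> f u <= q u) ->
  exists p : E -> R^o, [/\ linear p, forall u, V u -> p u = f u &
    forall u, p u <= q u].
Proof.
move=> V0 VP fP fq.
have f0 : f 0 = 0 by have := fP (-1) 0 0 V0 V0; rewrite scaler0 addr0; lra.
have [|G [G0G domG totG]] :=
    hahn_banach_graph [set p : E * R^o | V p.1 /\ p.2 = f p.1].
  split; first by [].
  - by move=> a [x r] [y s] /= [Vx ->] [Vy ->]; rewrite fP//;
      split=> //; exact: VP.
  - by move=> [x r] /= [Vx ->]; exact: fq.
have [p Gp] := choice totG; have [_ GP Gq] := domG.
exists p; split=> [a u v|u Vu|u]; last exact: (Gq (u, p u)).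
- apply: dominated_graph_fun domG (Gp _) _.
  exact: (GP a (u, p u) (v, p v)).
- by apply: dominated_graph_fun domG (Gp _) _; exact: G0G.
Qed.

End hahn_banach.

(** * Bounded functionals and the finite values of the seminorm *)

Lemma bounded_topological_dual {R : realType} {E : normedModType R}
    (p : E -> R^o) (C : R) :
  linear p -> (forall u, `|p u| <= C * `|u|) -> topological_dual p.
Proof.
move=> p_lin pC; split=> //.
pose pL := HB.pack_for {linear E -> R^o} p
  (GRing.isLinear.Build R E R^o _ p p_lin).
apply: (@bounded_linear_continuous _ _ _ pL); apply/linear_boundedP.
near=> r; move=> u.
by apply: le_trans (pC u) _; rewrite ler_wpM2r.
Unshelve. all: by end_near. Qed.

Section seminorm.
Context {R : realType} {H : normedModType R}.
Context {psi : ext_seminorm H}.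
Implicit Types u v : Hpsi psi.

Definition fpsi u : R := fine (psi (val u)).

Lemma fpsiE u : (fpsi u)%:E = psi (val u).
Proof.
by rewrite fineK// ge0_fin_numE ?ext_seminorm_ge0//; exact: (valP u).
Qed.

Lemma fpsi_ge0 u : 0 <= fpsi u.
Proof. exact/fine_ge0/ext_seminorm_ge0. Qed.

Lemma fpsi0 : fpsi 0 = 0.
Proof. by rewrite /fpsi ext_seminorm0. Qed.

Lemma fpsiD u v : fpsi (u + v) <= fpsi u + fpsi v.
Proof. by rewrite -lee_fin EFinD !fpsiE; exact: ext_seminormD. Qed.

Lemma fpsiZ a u : fpsi (a *: u) = `|a| * fpsi u.
Proof. by apply: EFin_inj; rewrite EFinM !fpsiE -ext_seminormZ. Qed.

Lemma fpsi_convex u v {t} : 0 <= t -> t <= 1 ->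
  fpsi (t *: u + (1 - t) *: v) <= t * fpsi u + (1 - t) * fpsi v.
Proof.
move=> t0 t1; apply: le_trans (fpsiD _ _) _.
by rewrite !fpsiZ !ger0_norm ?subr_ge0.
Qed.

Lemma Hpsi_normE u : `|u| = `|val u| + fpsi u.
Proof. by []. Qed.

Lemma HpsiP {x} : (psi x < +oo)%E -> exists u, val u = x.
Proof. by move=> x_fin; exists (HpsiElt x_fin). Qed.

End seminorm.

(** * Inner product and orthogonal projection *)

Section hilbert_lemmas.
Context {R : realType} {H : normedModType R}.
Context {ip : {dot H for idfun}}.
Hypothesis ip_norm : forall u : H, `|u| ^+ 2 = ip u u.

Lemma ipC u v : ip u v = ip v u.
Proof. by rewrite hermC expr0 mul1r. Qed.

Lemma ipDl u v w : ip (u + v) w = ip u w + ip v w.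
Proof. exact: linearDl. Qed.

Lemma ipZl a u v : ip (a *: u) v = a * ip u v.
Proof. exact: linearZl_LR. Qed.

Lemma ipNl u v : ip (- u) v = - ip u v.
Proof. exact: linearNl. Qed.

Lemma ipDr u v w : ip w (u + v) = ip w u + ip w v.
Proof. exact: linearDr. Qed.

Lemma ipZr a u v : ip v (a *: u) = a * ip v u.
Proof. exact: linearZr_LR. Qed.

Lemma ipNr u v : ip v (- u) = - ip v u.
Proof. exact: linearNr. Qed.

Definition ipE := (ipDl, ipDr, ipNl, ipNr, ipZl, ipZr).

Lemma normD_sqr u v : `|u + v| ^+ 2 = `|u| ^+ 2 + 2 * ip u v + `|v| ^+ 2.
Proof. by rewrite !ip_norm !ipE (ipC v u); ring. Qed.

Lemma cauchy_schwarz u v : `|ip u v| <= `|u| * `|v|.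
Proof.
rewrite -ler_sqr ?nnegrE// ?mulr_ge0// real_normK ?num_real// exprMn.
have [->|u0] := eqVneq u 0.
  by rewrite (_ : ip 0 v = 0) ?normr0 ?expr0n/= ?mul0r//
    -(scale0r 0) ipZl mul0r.
have uu : 0 < `|u| ^+ 2 by rewrite exprn_gt0// normr_gt0.
(* This vector is [|u|^2] times the component of [v] orthogonal to [u]. *)
have := sqr_ge0 `| `|u| ^+ 2 *: v + (- ip u v) *: u |.
rewrite normD_sqr !normrZ !exprMn !ipE (ipC v u) !real_normK ?num_real//.
set a := `|u| ^+ 2 in uu *; set b := `|v| ^+ 2; set c := ip u v.
rewrite (_ : _ + _ = a * (a * b - c ^+ 2)); last by ring.
by rewrite pmulr_rge0// subr_ge0.
Qed.

(** Two candidates differ by an element of [V] that is orthogonal to itself, so the choice made by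
    [xget] is forced. *)
Lemma orth_proj_eq (V : lin_subspace H) x p :
  V p -> (forall v, V v -> ip (x - p) v = 0) -> orth_proj ip V x = p.
Proof.
move=> Vp xp; apply: xget_unique => //= p' [Vp' xp'].
have Vd : V (p - p') by rewrite -scaleN1r addrC; exact: subspaceP.
apply/eqP; rewrite -subr_eq0 -normr_eq0 -sqrf_eq0; apply/eqP.
have := xp _ Vd; have := xp' _ Vd.
rewrite -normrN opprB ip_norm => xp'd xpd.
have -> : ip (p - p') (p - p') = ip (x - p') (p - p') - ip (x - p) (p - p').
  by rewrite -ipNl -ipDl; congr (ip _ _); rewrite opprB [RHS]addrC addrA subrK.
by rewrite xp'd xpd subrr.
Qed.

End hilbert_lemmas.

(** * Proximal minimization and the Moreau decomposition *)

Section prox.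
Context {R : realType} {H : completeNormedModType R}.
Context {ip : {dot H for idfun}}.
Hypothesis ip_norm : forall u : H, `|u| ^+ 2 = ip u u.
Context {psi : ext_seminorm H}.
Hypothesis psi_lsc : lower_semicontinuous psi.

Section objective.
Variables (c : R) (x : H).
Hypothesis c_gt0 : 0 < c.

Definition prox_obj (u : Hpsi psi) : R := `|val u - x| ^+ 2 + c * fpsi u.

(** The parallelogram identity handles the quadratic term and convexity the seminorm. Near the
    infimum the midpoint value cannot drop much, which forces [u] and [v] together. *)
Lemma prox_obj_midpoint (u v : Hpsi psi) :
  `|val u - val v| ^+ 2 + 4 * prox_obj (2^-1 *: u + (1 - 2^-1) *: v) <=
  2 * prox_obj u + 2 * prox_obj v.
Proof.
have half_le1 : 2^-1 <= 1 :> R by lra.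
have half_ge0 : 0 <= 2^-1 :> R by lra.
have := fpsi_convex u v half_ge0 half_le1.
rewrite /prox_obj; set d := 2^-1 *: u + _ => d_le.
pose a := val u - x; pose b := val v - x.
have -> : val u - val v = a - b by rewrite /a /b opprB addrA subrK.
have -> : val d - x = 2^-1 *: (a + b).
  rewrite /d /= (_ : 1 - 2^-1 = 2^-1); last by lra.
  have {1}-> : x = 2^-1 *: (x + x).
    by rewrite -mulr2n -(scaler_nat 2 x) scalerA mulVf ?scale1r ?pnatr_eq0.
  by rewrite -scalerDr -scalerBr opprD addrACA.
rewrite -/a -/b normrZ exprMn !(normD_sqr ip_norm a) normrN ipNr.
rewrite gtr0_norm ?invr_gt0//.
have := ler_wpM2l (ltW c_gt0) d_le. lra.
Qed.

(** Direct method: a minimizing sequence is Cauchy for the norm of [H], and lower semicontinuity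
    shows both that its limit has finite [psi] and that it attains the infimum. *)
Lemma prox_exists : exists w, forall u, prox_obj w <= prox_obj u.
Proof.
have obj_ge0 u : 0 <= prox_obj u.
  by rewrite addr_ge0 ?exprn_ge0// mulr_ge0 ?fpsi_ge0// ltW.
pose m := inf (range prox_obj).
have lb_obj : has_inf (range prox_obj).
  by split; [exists (prox_obj 0), 0 | exists 0 => _ [u _ <-]].
have m_le u : m <= prox_obj u by apply: ge_inf; [exact: lb_obj.2|exists u].
have us_ex (n : nat) : exists u, prox_obj u < m + n.+1%:R^-1.
  have [|_ [u _ <-]] :=
    inf_adherent (E := range prox_obj) (eps := n.+1%:R^-1) _ lb_obj.
    by rewrite invr_gt0.
  by exists u.
have [us usE] := choice us_ex.
pose vs n := val (us n).
have vs_dist p n : `|vs p - vs n| ^+ 2 <= 2 * (p.+1%:R^-1 + n.+1%:R^-1).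
  have := prox_obj_midpoint (us p) (us n); have := usE p; have := usE n.
  have := m_le (2^-1 *: us p + (1 - 2^-1) *: us n); rewrite -/(vs p) -/(vs n).
  move: (p.+1%:R^-1) (n.+1%:R^-1) => e e'; lra.
have vs_cauchy : cauchy (vs @ \oo).
  apply: cauchy_exP => e e0.
  have e4 : 0 < e ^+ 2 / 4 by rewrite divr_gt0// exprn_gt0.
  have [N _ hN] := near_infty_natSinv_lt (PosNum e4).
  exists (vs N); exists N => // n /= Nn; rewrite -ball_normE /=.
  rewrite -ltr_sqr ?nnegrE ?(ltW e0)// -/(vs n).
  apply: le_lt_trans (vs_dist N n) _.
  have := hN N (leqnn N); have := hN n Nn; rewrite /=.
  move: (N.+1%:R^-1) (n.+1%:R^-1) => a a'; lra.
pose l := lim (vs @ \oo).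
have vsl : vs @ \oo --> l. by exact: cauchy_cvg.
(* At this stage [psi l] may still be infinite, so the limit is taken against an arbitrary real
   level [a] below it. *)
have bound a : (a%:E < psi l)%E -> `|l - x| ^+ 2 + c * a <= m.
  move=> /psi_lsc [V Vl psiV].
  have h1 : `|vs n - x| ^+ 2 + c * a - n.+1%:R^-1 @[n --> \oo]
      --> `|l - x| ^+ 2 + c * a - 0.
    apply: cvgB; last exact: cvg_harmonic.
    apply: cvgD; last exact: cvg_cst.
    apply: (@cvgM _ _ _ _ (fun n => `|vs n - x|) (fun n => `|vs n - x|));
      by apply: cvg_norm; apply: cvgB => //; exact: cvg_cst.
  rewrite -[leLHS]subr0; apply: (cvgr_to_le h1); near=> n.
  have : V (vs n) by near: n; exact: vsl.
  move=> /psiV; rewrite /vs -fpsiE lte_fin => a_lt.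
  have := usE n; rewrite /prox_obj; move: n.+1%:R^-1 => e.
  have : c * a <= c * fpsi (us n) by rewrite ler_pM2l// ltW.
  lra.
have psi_l : (psi l <= ((m - `|l - x| ^+ 2) / c)%:E)%E.
  rewrite leNgt; apply/negP.
  set b := _ / c => b_lt.
  have [a b_a a_lt] : exists2 a : R, b < a & (a%:E < psi l)%E.
    case: (psi l) b_lt => [r| |]//.
      by rewrite lte_fin => br; exists ((b + r) / 2); rewrite ?lte_fin; lra.
    by move=> _; exists (b + 1); rewrite ?ltry// ltrDl.
  have := bound _ a_lt; move: b_a; rewrite ltr_pdivrMr//; lra.
have [w wl] := HpsiP (le_lt_trans psi_l (ltry _)).
exists w => u; apply: le_trans (m_le u).
move: psi_l; rewrite -wl -fpsiE lee_fin ler_pdivlMr// /prox_obj; lra.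
Unshelve. all: by end_near. Qed.

(** Convexity bounds the increment of [psi] along the segment linearly in [t]; dividing by [t]
    leaves an error of order [t]. Minimality is assumed only along one segment, so that minimizers
    over a translate of [V1] qualify too. *)
Lemma prox_variational (w d : Hpsi psi) :
  (forall t, 0 < t -> t <= 1 -> prox_obj w <= prox_obj (w + t *: d)) ->
  2 * ip (x - val w) (val d) <= c * (fpsi (w + d) - fpsi w).
Proof.
move=> w_min; rewrite -subr_ge0; set A := _ - _.
pose B := `|val d| ^+ 2; have B0 : 0 <= B by exact: exprn_ge0.
have ge0 t : 0 < t -> t <= 1 -> 0 <= A + t * B.
  move=> t0 t1; rewrite -(pmulr_rge0 _ t0).
  have := w_min t t0 t1; rewrite /prox_obj.
  have -> : val (w + t *: d) - x = (val w - x) + t *: val d.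
    by rewrite /= addrAC.
  rewrite (normD_sqr ip_norm (val w - x)) normrZ exprMn ipZr.
  rewrite real_normK ?num_real//.
  have := fpsi_convex (w + d) w (ltW t0) t1.
  have -> : t *: (w + d) + (1 - t) *: w = w + t *: d.
    by rewrite scalerDr scalerBl scale1r addrC addrA subrK.
  move=> /(ler_wpM2l (ltW c_gt0)).
  rewrite /A -[x - val w]opprB ipNl /B.
  lra.
rewrite leNgt; apply/negP => A0.
have BA : 0 < B - A by lra.
(* If [A < 0], this [t] lies in [(0, 1]] and makes [A + t * B] equal to [- A^2 / (B - A)], which is
   negative. *)
have := ge0 (- A / (B - A)); rewrite divr_gt0 ?oppr_gt0// ler_pdivrMr//.
have -> : A + - A / (B - A) * B = - (A ^+ 2 / (B - A)).
  by field; rewrite gt_eqF.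
have : 0 < A ^+ 2 / (B - A) by rewrite divr_gt0// exprn_even_gt0//= lt_eqF.
set r := A ^+ 2 / _ => r0; rewrite mul1r => /(_ isT); lra.
Qed.

End objective.

Context {K : set H}.
Hypothesis K_conj : forall u,
  conjugate ip psi u = if u \in K then 0%E else +oo%E.

(** The conjugate takes only the values 0 and [+oo], so membership in [K] amounts to the conjugate
    being at most 0. Points of infinite [psi] contribute [-oo] to the supremum. *)
Lemma polarP k : K k <-> forall u : Hpsi psi, ip (val u) k <= fpsi u.
Proof.
split=> [Kk u|k_le].
  have : ((ip (val u) k)%:E - psi (val u) <= conjugate ip psi k)%E.
    by apply: ereal_sup_ubound; exists (val u).
  by rewrite K_conj ifT ?mem_set// -fpsiE -EFinB lee_fin subr_le0.
have : (conjugate ip psi k <= 0)%E.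
  apply: ge_ereal_sup => _ [v _ <-].
  have [vfin|] := ltP (psi v) +oo%E; last first.
    by rewrite leye_eq => /eqP ->; exact: leNye.
  have [u <-] := HpsiP vfin.
  by rewrite -fpsiE -EFinB lee_fin subr_le0.
by rewrite K_conj; case: ifPn => [/set_mem|].
Qed.

Section decomposition.
Context {alpha : R}.
Hypothesis alpha_gt0 : 0 < alpha.

(* The two conditions say that [k] is a subgradient of [alpha * psi] at [w]. *)
Lemma nearest_scale_polar (w : Hpsi psi) (k : H) :
  ip k (val w) = alpha * fpsi w ->
  (forall y : Hpsi psi, ip k (val y) <= alpha * fpsi y) ->
  nearest (scale_set alpha K) (val w + k) = k.
Proof.
move=> kw k_le; set x := val w + k.
have xk : x - k = val w by rewrite /x addrK.
(* The variational inequality of the projection, with the square [|k - q|^2] retained: it gives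
   minimality of [k] and also its uniqueness. *)
have dist_le q : scale_set alpha K q ->
    `|x - k| ^+ 2 + `|k - q| ^+ 2 <= `|x - q| ^+ 2.
  move=> [k' /polarP k'_le <-].
  have -> : x - alpha *: k' = (x - k) + (k - alpha *: k').
    by rewrite addrA subrK.
  rewrite [leRHS](normD_sqr ip_norm) lerD2r lerDl mulr_ge0//.
  by rewrite xk ipDr ipNr ipZr ipC kw subr_ge0 ler_pM2l.
have kK : scale_set alpha K k.
  exists (alpha^-1 *: k); last by rewrite scalerA divff ?gt_eqF ?scale1r.
  by apply/polarP => u; rewrite ipZr ler_pdivrMl// ipC.
apply: xget_unique => /=.
  split=> // q /dist_le xkq; rewrite -ler_sqr ?nnegrE//; apply: le_trans xkq.
  by rewrite lerDl exprn_ge0.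
move=> q [/dist_le kq q_min].
have := q_min _ kK; rewrite -ler_sqr ?nnegrE ?normr_ge0// => qk.
apply/eqP; rewrite eq_sym -subr_eq0 -normr_eq0 -sqrf_eq0 eq_le sqr_ge0 andbT.
lra.
Qed.

(** [w] is the proximal point of [x]. Testing the variational inequality in the directions [w] and
    [- w] gives the equality by homogeneity, and [y - w] then gives the bound. *)
Lemma moreau_decomposition (x : H) : exists (w : Hpsi psi) (k : H),
  [/\ x = val w + k, ip k (val w) = alpha * fpsi w &
      forall y : Hpsi psi, ip k (val y) <= alpha * fpsi y].
Proof.
have c0 : 0 < 2 * alpha by exact: mulr_gt0.
have [w w_min] := prox_exists _ x c0.
have w_var d : ip (x - val w) (val d) <= alpha * (fpsi (w + d) - fpsi w).
  have := prox_variational _ x c0 w d (fun t _ _ => w_min _); lra.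
exists w, (x - val w); set k := x - val w in w_var *.
have kw : ip k (val w) = alpha * fpsi w.
  apply/eqP; rewrite eq_le; apply/andP; split.
    have := w_var w.
    have -> : w + w = 2 *: w by rewrite scaler_nat mulr2n.
    by rewrite fpsiZ ger0_norm//; lra.
  have := w_var (- w); rewrite subrr fpsi0 /= ipNr; lra.
split=> [|//|y]; first by rewrite /k addrC subrK.
by have := w_var (y - w); rewrite (addrC w) subrK ipDr ipNr; lra.
Qed.

Lemma shrink_subgradient (x : H) :
  exists w : Hpsi psi, let k := nearest (scale_set alpha K) x in
  [/\ val w = shrink alpha K x, ip k (val w) = alpha * fpsi w &
      forall y : Hpsi psi, ip k (val y) <= alpha * fpsi y].
Proof.
have [w [k [-> kw k_le]]] := moreau_decomposition x.
by exists w; rewrite /shrink nearest_scale_polar// addrK.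
Qed.

(** As [psi] is even, negating both parts of the decomposition of [x] gives that of [- x]. *)
Lemma nearest_scale_polarN (x : H) :
  nearest (scale_set alpha K) (- x) = - nearest (scale_set alpha K) x.
Proof.
have [w [k [-> kw k_le]]] := moreau_decomposition x.
rewrite [in RHS]nearest_scale_polar// opprD -[- val w]/(val (- w)).
have fpsiN y : fpsi (- y : Hpsi psi) = fpsi y.
  by rewrite -scaleN1r fpsiZ normrN1 mul1r.
apply: nearest_scale_polar => [|y]; first by rewrite fpsiN /= ipNl ipNr opprK.
by have := k_le (- y); rewrite fpsiN ipNl -ipNr.
Qed.

End decomposition.

End prox.

Lemma subspaceD {R : realType} {E : normedModType R} (V : lin_subspace E) u v :
  V u -> V v -> V (u + v).
Proof. by move=> Vu Vv; rewrite -[u]scale1r; exact: subspaceP. Qed.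

Lemma subspaceN {R : realType} {E : normedModType R} (V : lin_subspace E) u :
  V u -> V (- u).
Proof.
move=> Vu; rewrite -scaleN1r -[_ *: _]addr0; apply: subspaceP => //.
exact: subspace0.
Qed.

(** * Optimality conditions on the orthogonal splitting *)

Section splitting.
Context {R : realType} {H : completeNormedModType R}.
Context {ip : {dot H for idfun}}.
Hypothesis ip_norm : forall u : H, `|u| ^+ 2 = ip u u.
Context {psi : ext_seminorm H} {V1 V2 : lin_subspace H}.
Hypothesis V12_orth : forall v1 v2, V1 v1 -> V2 v2 -> ip v1 v2 = 0.
Hypothesis V12_sum : forall u : H,
  exists v1 v2, [/\ V1 v1, V2 v2 & u = v1 + v2].

Lemma orth_projP u : V1 (u - orth_proj ip V2 u) /\ V2 (orth_proj ip V2 u).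
Proof.
have [v1 [v2 [Vv1 Vv2 ->]]] := V12_sum u.
rewrite (orth_proj_eq ip_norm _ _ v2) ?addrK// => v Vv.
exact: V12_orth.
Qed.

Context { pi2 : {linear Hpsi psi -> subspace_type (psi_subspace psi V2)}}.
Hypothesis pi2E : forall u : Hpsi psi,
  val (val (pi2 u)) = orth_proj ip V2 (val u).

Lemma pi2_decomp (v : Hpsi psi) : V1 (val (v - val (pi2 v))).
Proof. by rewrite /= pi2E; exact: (orth_projP _).1. Qed.

Lemma pi2_eq0 (v : Hpsi psi) : V1 (val v) -> pi2 v = 0.
Proof.
move=> Vv; apply/val_inj/val_inj; rewrite pi2E /=.
apply: (orth_proj_eq ip_norm) => [|w Vw]; first exact: subspace0.
by rewrite subr0; exact: V12_orth.
Qed.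

Context {alpha : R}.
Hypothesis alpha_gt0 : 0 < alpha.
Context {u2 z : H}.

Lemma penalizedE {u : H} {w : Hpsi psi} : val w = u + u2 ->
  penalized psi alpha u2 z u = (`|u - z| ^+ 2 + 2 * alpha * fpsi w)%:E.
Proof. by move=> wE; rewrite /penalized -wE -fpsiE -EFinM -EFinD. Qed.

Lemma penalized_fin (u : H) : (penalized psi alpha u2 z u < +oo)%E ->
  exists w : Hpsi psi, val w = u + u2.
Proof.
move=> J_fin; apply: HpsiP; rewrite ltey; apply/eqP => u_oo.
by move: J_fin; rewrite /penalized u_oo gt0_muley ?lte_fin ?mulr_gt0.
Qed.

Lemma optimality_argmin (u1 : H) : V1 u1 ->
  optimality ip alpha pi2 u2 z u1 ->
  argmin (V1 : set H) (penalized psi alpha u2 z) = [set u1].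
Proof.
move=> Vu1 [_ [xi [xi_lin _] <-] [w wE [p [_ _ p_sub] eq0]]].
have xi0 : xi 0 = 0.
  by have := xi_lin (-1) 0 0; rewrite scaler0 addr0 scaleN1r addNr.
have apE v : V1 (val v) -> alpha * p v = ip (z - u1) (val v).
  move=> Vv; have : _ = 0 :> R := congr1 (fun f => f v) eq0.
  rewrite !fctE /embed /adjoint /= pi2_eq0// xi0 ipDl ipNl /GRing.scale /=; lra.
(* The excess [|u - u1|^2] yields uniqueness of the minimizer along with minimality. *)
have J_growth u : V1 u ->
    (penalized psi alpha u2 z u1 + (`|u - u1| ^+ 2)%:E <=
     penalized psi alpha u2 z u)%E.
  move=> Vu.
  have [/penalized_fin[w' w'E]|] := ltP (penalized psi alpha u2 z u) +oo%E;
    last by rewrite leye_eq => /eqP ->; exact: leey.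
  rewrite (penalizedE wE)// (penalizedE w'E)// -EFinD lee_fin.
  have dE : val (w' - w) = u - u1.
    by rewrite /= w'E wE opprD addrACA subrr addr0.
  have Vd : V1 (val (w' - w)).
    by rewrite dE; apply: subspaceD => //; exact: subspaceN.
  have := p_sub w'; rewrite -!fpsiE -EFinD lee_fin => p_le.
  have := ler_wpM2l (ltW alpha_gt0) p_le; rewrite mulrDr apE// dE.
  have -> : u - z = (u1 - z) + (u - u1) by rewrite [RHS]addrC addrA subrK.
  rewrite (normD_sqr ip_norm (u1 - z)) -[z - u1]opprB ipNl; lra.
have J_fin := penalizedE wE.
apply/seteqP; split=> [u [Vu /(_ _ Vu1) Ju]|_ ->] /=; last first.
  split=> // u Vu; apply: le_trans (J_growth _ Vu).
  by rewrite leeDl// lee_fin sqr_ge0.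
have := le_trans (J_growth _ Vu) Ju; rewrite J_fin -EFinD lee_fin gerDl.
move=> d_le0.
apply/eqP; rewrite -subr_eq0 -normr_eq0 -sqrf_eq0 eq_le d_le0.
exact: sqr_ge0.
Qed.

Lemma argmin_optimality (u1 : H) : (psi u2 < +oo)%E ->
  argmin (V1 : set H) (penalized psi alpha u2 z) u1 ->
  optimality ip alpha pi2 u2 z u1.
Proof.
move=> u2_fin [Vu1 u1_min].
(* The competitor [0] in [V1] has finite objective because [psi u2] is finite, hence so does
   [u1]. *)
have [w wE] : exists w : Hpsi psi, val w = u1 + u2.
  apply: penalized_fin; apply: le_lt_trans (u1_min _ (subspace0 V1)) _.
  have [w wE] := HpsiP u2_fin.
  by rewrite (@penalizedE 0 w) ?add0r ?ltry.
(* Translating by [u2] turns the objective on [V1] into [prox_obj] centred at [z + u2], so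
   [prox_variational] applies along [V1]. *)
have w_obj u d : val d = u -> prox_obj (2 * alpha) (z + u2) (w + d) =
    `|u1 + u - z| ^+ 2 + 2 * alpha * fpsi (w + d).
  move=> <-; rewrite /prox_obj /= wE; congr (`|_| ^+ 2 + _).
  by rewrite (addrAC u1) opprD addrACA subrr addr0.
have c0 : 0 < 2 * alpha by exact: mulr_gt0.
have variational d : V1 (val d) ->
    alpha^-1 * ip (z - u1) (val d) <= fpsi (w + d) - fpsi w.
  move=> Vd; rewrite ler_pdivrMl//.
  have := prox_variational ip_norm (2 * alpha) (z + u2) c0 w d.
  have -> : z + u2 - val w = z - u1 by rewrite wE opprD addrACA subrr addr0.
  move=> w_var.
  suff : 2 * ip (z - u1) (val d) <= 2 * alpha * (fpsi (w + d) - fpsi w).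
    by lra.
  apply: w_var => t t0 t1; rewrite (w_obj (t *: val d))//.
  rewrite -{1}[w]addr0 (w_obj 0)//.
  have Vt : V1 (u1 + t *: val d) by rewrite addrC; exact: subspaceP.
  have := u1_min _ Vt; rewrite (penalizedE wE)//.
  by rewrite (@penalizedE _ (w + t *: d)) ?lee_fin ?addr0//= wE addrAC.
pose q (v : Hpsi psi) := fpsi (w + v) - fpsi w.
have q_convex t x y : 0 < t -> t < 1 ->
    q (t *: x + (1 - t) *: y) <= t * q x + (1 - t) * q y.
  move=> /ltW t0 /ltW t1; rewrite /q.
  have -> : w + (t *: x + (1 - t) *: y) = t *: (w + x) + (1 - t) *: (w + y).
    by rewrite !scalerDr addrACA -scalerDl (addrC t) subrK scale1r.
  have := fpsi_convex (w + x) (w + y) t0 t1; lra.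
have f_lin (a : R) (u v : Hpsi psi) : V1 (val u) -> V1 (val v) ->
    alpha^-1 * ip (z - u1) (val (a *: u + v)) =
    a * (alpha^-1 * ip (z - u1) (val u)) + alpha^-1 * ip (z - u1) (val v).
  by move=> _ _; rewrite /= ipDr ipZr; ring.
have [p [p_lin pV1 p_le]] := hahn_banach q q_convex (psi_subspace psi V1) _
  (subspace0 (psi_subspace psi V1)) (@subspaceP _ _ (psi_subspace psi V1))
  f_lin variational.
have p_fpsi v : p v <= fpsi v.
  by apply: le_trans (p_le v) _; rewrite /q lerBlDl fpsiD.
have pN v : p (- v) = - p v.
  have p0 : p 0 = 0.
    by have := p_lin (-1) 0 0; rewrite scaler0 addr0 scaleN1r addNr.
  by have := p_lin (-1) v 0; rewrite !scaleN1r p0 !addr0.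
have p_norm v : `|p v| <= 1 * `|v|.
  rewrite mul1r Hpsi_normE ler_norml lerNl -pN.
  have fpsiN : fpsi (- v) = fpsi v by rewrite -scaleN1r fpsiZ normrN1 mul1r.
  have := p_fpsi v; have := p_fpsi (- v); rewrite fpsiN => pv pv'.
  by apply/andP; split; rewrite (le_trans pv, le_trans pv')// lerDr.
(* The value forced by the inclusion: on [V2^psi] the multiplier must be [z - u1] minus [alpha]
   times the subgradient. *)
pose xi (v : subspace_type (psi_subspace psi V2)) : R^o :=
  ip (z - u1) (val (val v)) - alpha * p (val v).
exists (adjoint pi2 xi).
  exists xi => //; apply: (bounded_topological_dual _ (`|z - u1| + alpha)).
    move=> a u v; rewrite /xi /= ipDr ipZr p_lin /GRing.scale /=; ring.
  move=> v; apply: le_trans (ler_normB _ _) _; rewrite mulrDl lerD//.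
    apply: le_trans (cauchy_schwarz ip_norm _ _) _.
    by rewrite ler_wpM2l// [leRHS]Hpsi_normE lerDl fpsi_ge0.
  rewrite normrM gtr0_norm// ler_pM2l//.
  by have := p_norm (val v); rewrite mul1r.
exists w => //; exists p.
  split; first exact: bounded_topological_dual p_norm.
    by rewrite -fpsiE.
  move=> y; rewrite -!fpsiE -EFinD lee_fin.
  by have := p_le (y - w); rewrite /q (addrC w) subrK; lra.
apply/funext => v; rewrite !fctE /embed /adjoint /xi.
(* Split [v] into [v - pi2 v], where [p] is prescribed by the extension, and [pi2 v], where the
   definition of [xi] cancels the rest. *)
have := pV1 _ (pi2_decomp v).
have -> : p (v - val (pi2 v)) = p v - p (val (pi2 v)).
  by have := p_lin 1 v (- val (pi2 v)); rewrite scale1r pN scale1r.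
move=> /(congr1 (fun r => alpha * r)); rewrite mulVKf ?gt_eqF//=.
rewrite !(ipDl, ipDr, ipNl, ipNr) /GRing.scale /= [0 v](_ : _ = 0)//; lra.
Qed.

Hypothesis psi_lsc : lower_semicontinuous psi.
Context {K : set H}.
Hypothesis K_conj : forall u,
  conjugate ip psi u = if u \in K then 0%E else +oo%E.
Hypothesis V1_z : V1 z.

Let u1_ eta := shrink alpha K (z + u2 - eta) - u2.

Lemma shrinkE eta :
  u1_ eta = z - eta - nearest (scale_set alpha K) (z + u2 - eta).
Proof. by rewrite /u1_ /shrink addrAC; congr (_ - _); rewrite addrAC addrK. Qed.

Lemma shrink_fixpoint eta : V2 eta ->
  V1 (u1_ eta) <->
  eta = orth_proj ip V2 (nearest (scale_set alpha K) (eta - (z + u2))).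
Proof.
move=> V2eta; rewrite -[eta - _]opprB.
rewrite (nearest_scale_polarN ip_norm psi_lsc K_conj)//.
set P := nearest _ _.
(* Since [z] is in [V1], both conditions reduce to [- P - eta] being in [V1], that is, to [eta]
   being the [V2] component of [- P]. *)
have u1E : u1_ eta = z + (- P - eta).
  by rewrite shrinkE -/P -addrA (addrC (- eta)).
split=> [Vu1|etaE].
  apply/esym/(orth_proj_eq ip_norm) => // v Vv; apply: V12_orth => //.
  rewrite -[_ - eta](addKr z) addrC -u1E addrC.
  by apply: subspaceD => //; exact: subspaceN.
rewrite u1E; apply: subspaceD => //; rewrite etaE.
exact: (orth_projP _).1.
Qed.

Lemma shrink_optimality eta : V2 eta ->
  optimality ip alpha pi2 u2 z (u1_ eta).
Proof.
move=> V2eta.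
have [w] := shrink_subgradient ip_norm psi_lsc K_conj alpha_gt0 (z + u2 - eta).
set P := nearest _ _ => -[wE Pw P_le].
pose xi (v : subspace_type (psi_subspace psi V2)) : R^o := ip eta (val (val v)).
have embed_dual (h : H) : topological_dual (embed ip psi h).
  apply: (bounded_topological_dual _ `|h|).
    by move=> a u v; rewrite /embed /= ipDr ipZr.
  move=> v; apply: le_trans (cauchy_schwarz ip_norm _ _) _.
  by rewrite ler_wpM2l// [leRHS]Hpsi_normE lerDl fpsi_ge0.
exists (adjoint pi2 xi).
  exists xi => //; apply: (bounded_topological_dual _ `|eta|).
    by move=> a u v; rewrite /xi /= ipDr ipZr.
  move=> v; apply: le_trans (cauchy_schwarz ip_norm _ _) _.
  by rewrite ler_wpM2l// [leRHS]Hpsi_normE lerDl fpsi_ge0.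
exists w; first by rewrite /u1_ subrK.
exists (embed ip psi (alpha^-1 *: P)).
  split=> [//||y]; first by rewrite -fpsiE.
  rewrite -!fpsiE -EFinD lee_fin /embed /= ipZl ipDr ipNr Pw.
  rewrite mulrBr mulKf ?gt_eqF//.
  by rewrite subrK ler_pdivrMl//; exact: P_le.
apply/funext => v; rewrite !fctE /embed /adjoint /xi /= [0 v](_ : _ = 0)//.
(* [eta] is orthogonal to [v - pi2 v], so its pairing with [v] is the pulled-back functional
   [adjoint pi2 xi]. *)
have := V12_orth _ _ (pi2_decomp v) V2eta.
rewrite (ipC eta) (shrinkE eta) -/P /GRing.scale /= ipZl mulVKf ?gt_eqF//.
rewrite !(ipDl, ipNl) (ipC _ eta); lra.
Qed.

End splitting.

(** * The equivalences and the implication between them *)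

Theorem theorem4p4 (R : realType) (H : completeNormedModType R)
  (ip : {dot H for idfun})
  (ip_norm : forall u : H, `|u| ^+ 2 = ip u u)
  (H_separable : exists2 D : set H, countable D & dense D)
  (psi : ext_seminorm H)
  (psi_lsc : lower_semicontinuous psi)
  (Hpsi_dense : dense [set u : H | (psi u < +oo)%E])
  (Hpsi_complete : forall F : set_system (Hpsi psi),
    ProperFilter F -> cauchy F -> cvg F)
  (tau : topology_on (Hpsi psi))
  (tau_compact : forall u : nat -> Hpsi psi,
    (exists M : R, forall n, `|u n| <= M) ->
    exists (k : nat -> nat) (l : Hpsi psi),
      {homo k : m n / (m < n)%N} /\ cvg_in tau (u \o k) l)
  (tau_lsc : forall (u : nat -> Hpsi psi) (l : Hpsi psi), cvg_in tau u l ->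
    (psi (val l) <= limn_einf (fun n => psi (val (u n))))%E)
  (K : set H) (K_closed : closed K) (K_convex : convex_set K)
  (K_conj : forall u : H,
    conjugate ip psi u = if u \in K then 0%E else +oo%E)
  (K_sym : K = [set - u | u in K])
  (V1 V2 : lin_subspace H)
  (V1_closed : closed (V1 : set H)) (V2_closed : closed (V2 : set H))
  (V12_orth : forall v1 v2, V1 v1 -> V2 v2 -> ip v1 v2 = 0)
  (V12_sum : forall u : H,
  exists v1 v2, [/\ V1 v1, V2 v2 & u = v1 + v2])
  (pi1 : {linear Hpsi psi -> subspace_type (psi_subspace psi V1)})
  (pi2 : {linear Hpsi psi -> subspace_type (psi_subspace psi V2)})
  (pi1E : forall u : Hpsi psi, val (val (pi1 u)) = orth_proj ip V1 (val u))
  (pi2E : forall u : Hpsi psi, val (val (pi2 u)) = orth_proj ip V2 (val u))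
  (pi1_cont : continuous pi1) (pi2_cont : continuous pi2)
  (V1psi_closed : closed (psi_subspace psi V1 : set (Hpsi psi)))
  (V2psi_closed : closed (psi_subspace psi V2 : set (Hpsi psi)))
  (alpha : R) (alpha_gt0 : 0 < alpha)
  (u2 : H) (V2_u2 : V2 u2) (psi_u2 : (psi u2 < +oo)%E)
  (z : H) (V1_z : V1 z) :
  let i_ u1 := argmin (V1 : set H) (penalized psi alpha u2 z) = [set u1] in
  let ii_ u1 := optimality ip alpha pi2 u2 z u1 in
  let u1_ eta := shrink alpha K (z + u2 - eta) - u2 in
  let iii_ eta := V2 eta /\ V1 (u1_ eta) in
  let iv_ eta := V2 eta /\
    eta = orth_proj ip V2 (nearest (scale_set alpha K) (eta - (z + u2))) in
  [/\ forall u1, V1 u1 -> (i_ u1 <-> ii_ u1),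
      (exists eta, iii_ eta) <-> (exists eta, iv_ eta) &
      forall eta, iii_ eta \/ iv_ eta -> i_ (u1_ eta) /\ ii_ (u1_ eta)].
Proof.
move=> i_ ii_ u1_ iii_ iv_.
have ii_i u1 : V1 u1 -> ii_ u1 -> i_ u1.
  exact: (optimality_argmin ip_norm V12_orth pi2E alpha_gt0).
have iii_iv eta : iii_ eta <-> iv_ eta.
  by split=> -[V2eta] /(shrink_fixpoint ip_norm V12_orth V12_sum alpha_gt0
    psi_lsc K_conj V1_z eta V2eta) ?.
split.
- move=> u1 Vu1; split; last exact: ii_i.
  move=> i_u1; apply: (argmin_optimality ip_norm V12_orth V12_sum pi2E) => //.
  by rewrite [X in X u1]i_u1.
- by split=> -[eta /iii_iv ?]; exists eta.
- move=> eta iii_or_iv.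
  have [V2eta Vu1] : iii_ eta by case: iii_or_iv => // /iii_iv.
  have ii_eta : ii_ (u1_ eta).
    exact: (shrink_optimality ip_norm V12_orth V12_sum pi2E).
  by split=> //; exact: ii_i.
Qed.
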